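(* Let $p$ be a hyperbolic polynomial of degree $n$ and let $h>0$. If $\theta\in(0,\pi)$ and $n\geq2$, or if $\theta=0$ and $n\geq3$, then $$\mathrm{mesh}\,\Delta_{\theta,h}(p)\geq\max\{\mathrm{mesh}\,p,\ \mathrm{mesh}\,\Delta_{\theta,h}(x^n)\}\geq\mathrm{mesh}\,\Delta_{\theta,h}(x^n).$$
   Context: A hyperbolic polynomial is a real polynomial with only real roots. For a hyperbolic polynomial $q(x)=C(x-x_1)\cdots(x-x_n)$, $C\neq0$, $x_1\leq x_2\leq\dots\leq x_n$, $n\ge 2$, its mesh is $\mathrm{mesh}(q)=\min_{1\leq j\leq n-1}(x_{j+1}-x_j)$ (so it is $0$ if $q$ has a multiple root); polynomials of degree at most $1$ have mesh $+\infty$. The operator is $$\Delta_{\theta,h}(p)(x)=\frac{e^{i\theta}p(x+ih)-e^{-i\theta}p(x-ih)}{2i},$$ which maps hyperbolic polynomials to hyperbolic polynomials (or zero) for real $h$. *)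

(* Defs.v *)
From HB Require Import structures.
From mathcomp Require Import all_boot all_order all_algebra.
From mathcomp Require Import all_classical all_reals all_analysis.
From mathcomp Require Import polyrcf complex ring.

Set Implicit Arguments.
Unset Strict Implicit.
Unset Printing Implicit Defensive.

Import Order.TTheory GRing.Theory Num.Theory.

Local Open Scope ring_scope.
Local Open Scope complex_scope.

Definition polyRC (R : realType) (p : {poly R}) : {poly R[i]} :=
  map_poly (real_complex R) p.

(* The zero polynomial is not hyperbolic. *)
Definition hyperbolic (R : realType) (p : {poly R}) : Prop :=
  p != 0 /\ forall z : R[i], root (polyRC p) z -> complex.Im z = 0.

(* [rootsR p] is the strictly increasing list of the real roots of [p]; each
   root is repeated according to its multiplicity. *)
Definition realroots (R : realType) (p : {poly R}) : seq R :=
  flatten [seq nseq (mup x p) x | x <- rootsR p].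

(* The minimum over an empty index set is +oo, so polynomials of degree at
   most 1 have mesh +oo. *)
Definition mesh (R : realType) (p : {poly R}) : \bar R :=
  let s := realroots p in
  \big[Order.min/+oo%E]_(0 <= j < (size s).-1) (s`_j.+1 - s`_j)%:E.

Definition expi (R : realType) (theta : R) : R[i] :=
  cos theta +i* sin theta.

Definition DeltaC (R : realType) (theta h : R) (p : {poly R[i]}) :
    {poly R[i]} :=
  (2 * 'i)^-1 *: (expi theta *: (p \Po ('X + ('i * h%:C)%:P))
                  - expi (- theta) *: (p \Po ('X - ('i * h%:C)%:P))).

(* [DeltaC] maps real polynomials to real polynomials, see [DeltaE]. *)
Definition Delta (R : realType) (theta h : R) (p : {poly R}) : {poly R} :=
  map_poly (@complex.Re R) (DeltaC theta h (polyRC p)).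

Lemma count_realroots (R : realType) (p : {poly R}) (x : R) :
  p != 0 -> count_mem x (realroots p) = mup x p.
Proof.
move=> p0; rewrite /realroots.
have Hin y : (y \in rootsR p) = root p y.
  have := roots_on_rootsR p0 => /(_ y); rewrite in_itv /= => <- //.
have Hu : uniq (rootsR p) by apply: uniq_roots.
rewrite count_flatten -map_comp.
have -> : [seq ((count_mem x) \o (fun y => nseq (mup y p) y)) y | y <- rootsR p]
        = [seq ((x == y) * mup x p)%N | y <- rootsR p].
  apply: eq_map => y /=; rewrite count_nseq /= eq_sym.
  by case: eqVneq => [->|].
rewrite sumnE big_map -big_distrl /=.
rewrite (_ : (\sum_(i <- rootsR p) (x == i))%N = (root p x)).
  case: (boolP (root p x)) => [_|/mupNroot ->]; rewrite ?mul1n ?muln0 //.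
rewrite -Hin -(count_uniq_mem _ Hu) -sum1_count [RHS]big_mkcond /=.
by apply: eq_bigr => y _; rewrite eq_sym; case: (_ == _).
Qed.

Lemma realroots_sorted (R : realType) (p : {poly R}) :
  sorted <=%R (realroots p).
Proof.
rewrite /realroots; have: sorted <%R (rootsR p) by apply: sorted_roots.
rewrite lt_sorted_pairwise (sorted_pairwise le_trans).
elim: (rootsR p) => //= x s IH /andP[/allP Hx /IH Hs].
rewrite pairwise_cat Hs andbT; apply/andP; split.
  apply/allrelP => a b /nseqP[-> _] /flattenP[_ /mapP[c /Hx cx ->]].
  by move=> /nseqP[-> _]; apply: ltW.
by elim: (mup x p) => //= k ->; rewrite andbT; apply/allP => a /nseqP[-> _].
Qed.

Lemma realroots_prod (R : realType) (C : R) (s : seq R) :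
  C != 0 -> sorted <=%R s ->
  realroots (C *: \prod_(x <- s) ('X - x%:P)) = s.
Proof.
move=> C0 ss; have q0 : \prod_(x <- s) ('X - x%:P) != 0 :> {poly R}.
  by apply/monic_neq0/monic_prod_XsubC.
apply: (sorted_eq le_trans le_anti) => //; first exact: realroots_sorted.
apply/allP => x _; rewrite /= count_realroots ?scaler_eq0 ?(negPf C0) //.
by rewrite -mul_polyC mupMr ?rootC // mu_prod_XsubC.
Qed.

Lemma polyRC_ReK (R : realType) (q : {poly R[i]}) :
  (forall i, complex.Im q`_i = 0) -> polyRC (map_poly (@complex.Re R) q) = q.
Proof.
move=> q_re; apply/polyP => i; rewrite coef_map coef_map_id0 //=.
by have := q_re i; case: (q`_i) => a b /= ->.
Qed.

Lemma DeltaE (R : realType) (theta h : R) (p : {poly R}) :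
  polyRC (Delta theta h p) = DeltaC theta h (polyRC p).
Proof.
apply: polyRC_ReK => i.
have conj_expi : (expi theta)^* = expi (- theta).
  by rewrite /expi /= cosN sinN.
have conj_ih : ('i * h%:C)^* = - ('i * h%:C).
  by apply/eqP; rewrite eq_complex /= !(mul0r, mulr0, mul1r, subr0, addr0, add0r, oppr0) !eqxx.
have conj_comp : map_poly conjc (polyRC p \Po ('X + ('i * h%:C)%:P)) =
    polyRC p \Po ('X - ('i * h%:C)%:P).
  rewrite map_comp_poly rmorphD /= map_polyX map_polyC [X in X%:P]conj_ih polyCN.
  congr (_ \Po _); apply/polyP => j; rewrite !coef_map /=.
  by rewrite oppr0.
rewrite /DeltaC -conj_comp -conj_expi coefZ coefB !coefZ coef_map /=.
set w := expi theta; set v := _`_i.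
have -> : w * v - w^* * v^* = (2 * 'i) * (complex.Im (w * v))%:C.
  by rewrite -(rmorphM (@conjc R)) subcJ mulrAC.
rewrite mulKf //.
by rewrite mulf_neq0 ?pnatr_eq0 // eq_complex /= oner_eq0 andbF.
Qed.

Lemma hyperbolic_prod (R : realType) (p : {poly R}) :
  hyperbolic p ->
  exists s : seq R, p = lead_coef p *: \prod_(x <- s) ('X - x%:P).
Proof.
case=> p0 hp; have [t tE] := closed_field_poly_normal (polyRC p).
exists [seq complex.Re z | z <- t].
apply: (map_poly_inj (real_complex R)); rewrite -/(polyRC p) tE.
rewrite map_polyZ /= lead_coef_map; congr (_ *: _).
rewrite rmorph_prod /= big_map big_seq [RHS]big_seq; apply: eq_bigr => z zt.
rewrite rmorphB /= map_polyX map_polyC /=; congr ('X - _%:P).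
have : complex.Im z = 0.
  apply: hp; rewrite tE rootZ ?lead_coef_eq0 ?map_poly_eq0 //.
  by rewrite root_prod_XsubC.
by case: z {zt} => a b /= ->.
Qed.

Lemma Delta_hyperbolic (R : realType) (theta h : R) (p : {poly R}) :
  0 < h -> hyperbolic p -> Delta theta h p != 0 ->
  hyperbolic (Delta theta h p).
Proof.
move=> h0 hp D0; split=> // z.
have [s pE] := hyperbolic_prod hp; case: hp => p0 _.
have PE u : (polyRC p).[u] = (lead_coef p)%:C * \prod_(x <- s) (u - x%:C).
  rewrite {1}pE /polyRC map_polyZ /= hornerZ; congr (_ * _).
  rewrite rmorph_prod horner_prod; apply: eq_bigr => x _.
  by rewrite /= rmorphB /= map_polyX map_polyC /= hornerXsubC.
have i20 : (2 * 'i : R[i])^-1 != 0.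
  by rewrite invr_eq0 mulf_neq0 ?pnatr_eq0 // eq_complex /= oner_eq0 andbF.
rewrite DeltaE /DeltaC rootZ // => zR; apply/eqP; apply: contraT => Im0.
have c0 : (lead_coef p)%:C != 0 :> R[i] by rewrite fmorph_eq0 lead_coef_eq0.
have nexpi t : `|expi t| = 1 :> R[i].
  by rewrite normc_def /= cos2Dsin2 sqrtr1.
case: s pE PE => [|x0 s] pE PE.
  have pC : p = (lead_coef p)%:P by rewrite {1}pE big_nil alg_polyC.
  move: D0 zR; rewrite -(map_poly_eq0 (real_complex R)) -/(polyRC _) DeltaE /DeltaC.
  rewrite pC /polyRC map_polyC /= !comp_polyC -!mul_polyC -!polyCM -polyCB -polyCM.
  by rewrite polyC_eq0 mulf_eq0 negb_or rootC => /andP[_ /negPf ->].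
move: zR; rewrite rootE hornerD hornerN !hornerZ !horner_comp !hornerD hornerN.
rewrite hornerX !hornerC !PE subr_eq0 => /eqP/(congr1 Num.norm).
rewrite !normrM !nexpi !mul1r => /(mulfI (etrans (congr1 negb (normr_eq0 _)) c0)).
rewrite !normr_prod => E.
pose f (a : R) := `|z + 'i * h%:C - a%:C|; pose g (a : R) := `|z - 'i * h%:C - a%:C|.
have fE a : f a = (Num.sqrt ((complex.Re z - a) ^+ 2 + (complex.Im z + h) ^+ 2))%:C.
  rewrite /f normc_def; case: (z) => b c /=.
  by rewrite !(mul0r, mulr0, mul1r, subr0, addr0, add0r, oppr0).
have gE a : g a = (Num.sqrt ((complex.Re z - a) ^+ 2 + (complex.Im z - h) ^+ 2))%:C.
  rewrite /g normc_def; case: (z) => b c /=.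
  by rewrite !(mul0r, mulr0, mul1r, subr0, addr0, add0r, oppr0).
have dif : (complex.Im z + h) ^+ 2 - (complex.Im z - h) ^+ 2 = 4 * h * complex.Im z.
  by rewrite subr_sqr; ring.
have lt_sqrt (a b c : R) : 0 <= c -> a < b -> 0 <= a -> Num.sqrt (c + a) < Num.sqrt (c + b).
  by move=> c0' ab a0; rewrite ltr_sqrt ?ltrD2l // ltr_wpDl // (le_lt_trans a0).
have [Ip|] := ltP 0 (complex.Im z).
- have : \prod_(a <- x0 :: s) g a < \prod_(a <- x0 :: s) f a.
    apply: ltr_prod => // a _; rewrite normr_ge0 /= fE gE ltcR.
    by rewrite lt_sqrt ?sqr_ge0 // -subr_gt0 dif !mulr_gt0.
  by rewrite -E ltxx.
rewrite le_eqVlt (negPf Im0) /= => In.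
have : \prod_(a <- x0 :: s) f a < \prod_(a <- x0 :: s) g a.
  apply: ltr_prod => // a _; rewrite normr_ge0 /= fE gE ltcR.
  by rewrite lt_sqrt ?sqr_ge0 // -subr_lt0 dif nmulr_llt0 // ?mulr_gt0.
by rewrite E ltxx.
Qed.

(* Main.v *)
(** On the real line [Delta theta h p] is, up to a nonvanishing factor, the sine
    of the decreasing phase [theta + \sum_j (pi / 2 - atan ((u - x_j) / h))], the
    [x_j] being the roots of [p].  Along a gap [u, w] between two roots of [Delta p] the
    phase drops by at least [pi]; shrinking [w] we may assume that it drops by
    exactly [pi].

    If [w - u <= mesh p], the intervals [u - x_j, w - x_j] do not overlap, so the
    drop is less than the total variation [pi] of [atan]: this gives [mesh p].

    For [x^n], write [a_j < b_j] for the values of [atan] at [(u - x_j) / h] and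
    [(w - x_j) / h], and [D = (w - u) / h = 2 tan mu].  Since
    [tan b_j - tan a_j = D], one gets
    [b_j - a_j = mu + asin (sin mu * cos (b_j + a_j))].
    The sum of the [e_j = b_j + a_j] is fixed modulo [2 pi], say equal to [E] with
    [|E| <= pi], and [\sum_j asin (sin mu * cos e_j)] is then at most
    [n asin (sin mu * cos (E / n))].  Hence [D] is at least the value for which
    all [e_j] are equal to [E / n], and this value is a gap of [Delta x^n]. *)
Require Import Defs.
From mathcomp Require Import all_boot all_order all_algebra.
From mathcomp Require Import all_classical all_reals all_analysis.
From mathcomp Require Import polyrcf complex ring lra.

Set Implicit Arguments.
Unset Strict Implicit.
Unset Printing Implicit Defensive.

Import Order.TTheory GRing.Theory Num.Theory.
Import numFieldNormedType.Exports.

Local Open Scope ring_scope.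

(** * A trigonometric inequality *)

Section Trig.
Variable R : realType.
Implicit Types (s x y e : R) (k m : int).

Lemma sin_intpi k : sin (k%:~R * pi) = 0 :> R.
Proof.
have nat_case (n : nat) : sin (n%:R * pi) = 0 :> R.
  by rewrite mulr_natl -[_ *+ n]add0r (alternatingn (@sinDpi R)) sin0 mulr0.
case: k => n; first exact: nat_case.
by rewrite NegzE mulrNz mulNr sinN nat_case oppr0.
Qed.

Lemma cosD2intpi m x : cos (x + m%:~R * (pi *+ 2)) = cos x.
Proof.
have nat_case (n : nat) (z : R) : cos (z + n%:R * (pi *+ 2)) = cos z.
  by rewrite mulr_natl; exact: (periodicn (@cosD2pi R)).
case: m => n; first exact: nat_case.
by rewrite -(nat_case n.+1) NegzE mulrNz mulNr subrK.
Qed.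

Lemma sin0_intpi x : sin x = 0 -> exists k, x = k%:~R * pi.
Proof.
move=> sx0; have pi0 : 0 < pi :> R := pi_gt0 R.
pose k := Num.floor (x / pi); exists k.
have := floor_le_tmp (x / pi); have := floorD1_gt (x / pi).
rewrite -/k intrD ltr_pdivrMr // ler_pdivlMr // mulrDl mul1r => xlt xge.
have /eqP s0 : sin (x - k%:~R * pi) = 0 by rewrite sinB sx0 sin_intpi; ring.
have [|ne] := boolP (x - k%:~R * pi == 0); first by rewrite subr_eq0 => /eqP.
have : 0 < sin (x - k%:~R * pi).
  by apply: sin_gt0_pi; rewrite lt_neqAle eq_sym ne subr_ge0 xge /= ltrBlDl.
by rewrite (eqP s0) ltxx.
Qed.

(** Rounding down [(x + pi / 2) / (2 pi)] leaves a remainder in [[- pi / 2, 3 pi / 2)], whose upper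
    half is brought back by [pi]. The parity [b] is recorded because a shift by [pi] changes the
    sign of a bump, while a shift by [2 pi] does not. *)
Lemma mod_pi_centered x : exists (m : int) (b : bool) (y : R),
  - (pi / 2) <= y <= pi / 2 /\ x = y + m%:~R * (pi *+ 2) + b%:R * pi.
Proof.
have pi0 : 0 < pi :> R := pi_gt0 R.
have pi20 : 0 < pi *+ 2 :> R by rewrite pmulrn_lgt0.
pose t := (x + pi / 2) / (pi *+ 2); pose m := Num.floor t.
have := floor_le_tmp t; have := floorD1_gt t.
rewrite -/m intrD ltr_pdivrMr // ler_pdivlMr // => xlt xge.
exists m; set z := m%:~R * _ in xge *.
have {}xlt : x + pi / 2 < z + pi *+ 2 by apply: lt_le_trans xlt _; rewrite /z; lra.
have [le|lt] := lerP (x - z) (pi / 2).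
  exists false, (x - z); split; last by rewrite mul0r addr0 subrK.
  by rewrite le andbT; lra.
by exists true, (x - z - pi); split; [apply/andP; split; lra|rewrite mul1r; ring].
Qed.

(* The difference of two arctangents is, up to a constant, a [bump] of their sum:
   see [atan_gap]. *)
Definition bump s e := asin (s * cos e).

Lemma bump_norm s e : bump s `|e| = bump s e.
Proof. by rewrite /bump cos_norm. Qed.

Lemma bumpD2intpi s e m : bump s (e + m%:~R * (pi *+ 2)) = bump s e.
Proof. by rewrite /bump cosD2intpi. Qed.

(** * Lipschitz bound, concavity and sums of bumps *)

Section Bump.
Variable s : R.
Hypotheses (s_ge0 : 0 <= s) (s_lt1 : s < 1).

Lemma bump_arg_lt1 e : -1 < s * cos e < 1.
Proof.
rewrite -ltr_norml normrM (ger0_norm s_ge0).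
by apply: le_lt_trans s_lt1; rewrite ler_piMr // cos_max.
Qed.

Let bump_arg_le1 e : -1 <= s * cos e <= 1.
Proof. by case/andP: (bump_arg_lt1 e) => *; rewrite !ltW. Qed.

Lemma sin_bump e : sin (bump s e) = s * cos e.
Proof. by rewrite asinK // in_itv /= bump_arg_le1. Qed.

Lemma bump_pihalf e : - (pi / 2) < bump s e < pi / 2.
Proof.
have /andP[lo hi] := bump_arg_lt1 e.
by rewrite asin_gtNpi2 ?asin_ltpi2 // ?lo ?hi ltW.
Qed.

Lemma bumpDpi e : bump s (e + pi) = - bump s e.
Proof.
have := bump_pihalf e; have := bump_pihalf (e + pi).
move=> /andP[a b] /andP[c d]; apply: sin_inj; rewrite ?in_itv /=.
- by rewrite !ltW.
- by apply/andP; split; lra.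
by rewrite sinN !sin_bump cosDpi mulrN.
Qed.

Lemma bump_ge0 e : - (pi / 2) <= e <= pi / 2 -> 0 <= bump s e.
Proof.
move=> he; have := bump_pihalf e; move=> /andP[a b].
rewrite leNgt; apply/negP => blt.
have : 0 < sin (- bump s e) by apply: sin_gt0_pihalf; apply/andP; split; lra.
rewrite sinN sin_bump oppr_gt0; apply/negP; rewrite -leNgt.
by rewrite mulr_ge0 // cos_ge0_pihalf.
Qed.

(** The opposite of the derivative of [bump s], so that it is nonnegative on [[0, pi]]. *)
Let slope e := s * sin e / Num.sqrt (1 - (s * cos e) ^+ 2).

Let rad_gt0 e : 0 < 1 - (s * cos e) ^+ 2.
Proof.
rewrite subr_gt0 -[_ ^+ 2]ger0_norm ?sqr_ge0 // normrX.
by rewrite expr_lt1 ?normr_ge0 // ltr_norml bump_arg_lt1.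
Qed.

Let is_derive_bump e : is_derive e 1 (bump s) (- slope e).
Proof.
have h : is_derive e 1 (fun x => s * cos x) (s * - sin e).
  exact: is_deriveZ.
have h2 := is_derive1_asin (bump_arg_lt1 e).
have := @is_derive1_comp R asin (fun x => s * cos x) e _ _ h2 h.
by rewrite /slope mulrC mulrN mulNr.
Qed.

Let bump_mvt x y : x <= y ->
  exists2 c, x <= c <= y & bump s y - bump s x = - slope c * (y - x).
Proof.
move=> xy; have [|c] := @MVT_segment R (bump s) (fun e => - slope e) x y xy
  (fun e _ => is_derive_bump e).
  apply: derivable_within_continuous => z _.
  by have [] := is_derive_bump z.
by rewrite in_itv /= => cxy eq; exists c.
Qed.

(** After squaring, the bound reads [s^2 sin^2 e <= 1 - s^2 cos^2 e], that is, [s^2 <= 1]. *)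
Let slope_norm e : `|slope e| <= 1.
Proof.
rewrite normrM normfV (ger0_norm (sqrtr_ge0 _)) ler_pdivrMr ?sqrtr_gt0 // mul1r.
rewrite -sqrtr_sqr ler_wsqrtr // !exprMn lerBrDr.
have := cos2Dsin2 e => h.
suff : s ^+ 2 * (cos e ^+ 2 + sin e ^+ 2) <= 1 by lra.
by rewrite h mulr1 expr_le1 // ltW.
Qed.

Lemma bump_lipschitz x y : `|bump s x - bump s y| <= `|x - y|.
Proof.
wlog le : x y / x <= y.
  move=> h; have [/h //|/h] := orP (le_total x y).
  by rewrite (distrC y) (distrC (bump s y)).
have [c _ eq] := bump_mvt le.
by rewrite distrC eq normrM normrN [`|x - y|]distrC ler_piMl.
Qed.

(* With [a], [b] the half sum and half difference of the two values,
   [sin a * cos b = s * cos m * cos d]; the Lipschitz bound [|b| <= |d|] gives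
   [cos d <= cos b]. *)
Lemma bump_midpoint x y : - (pi / 2) <= (x + y) / 2 <= pi / 2 ->
  `|x - y| <= pi *+ 2 -> bump s x + bump s y <= bump s ((x + y) / 2) *+ 2.
Proof.
set m := (x + y) / 2 => hm hd.
pose d := (x - y) / 2.
pose a := (bump s x + bump s y) / 2; pose b := (bump s x - bump s y) / 2.
have pi0 : 0 < pi :> R := pi_gt0 R.
have /andP[x1 x2] := bump_pihalf x; have /andP[y1 y2] := bump_pihalf y.
have /andP[m1 m2] := bump_pihalf m.
have cosb : 0 < cos b.
  by apply: cos_gt0_pihalf; rewrite /b; apply/andP; split; lra.
have sum : sin a * cos b = s * cos m * cos d.
  apply: (@mulfI R 2) => //.
  have -> : 2 * (sin a * cos b) = sin (a + b) + sin (a - b).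
    by rewrite sinD sinB; ring.
  have -> : 2 * (s * cos m * cos d) = s * (cos (m + d) + cos (m - d)).
    by rewrite cosD cosB; ring.
  have -> : a + b = bump s x by rewrite /a /b; field.
  have -> : a - b = bump s y by rewrite /a /b; field.
  have -> : m + d = x by rewrite /m /d; field.
  have -> : m - d = y by rewrite /m /d; field.
  by rewrite !sin_bump mulrDr.
have normd : `|d| = `|x - y| / 2 by rewrite normrM [X in _ * X]gtr0_norm ?invr_gt0.
have normb : `|b| = `|bump s x - bump s y| / 2.
  by rewrite normrM [X in _ * X]gtr0_norm ?invr_gt0.
have cosdb : cos d <= cos b.
  rewrite -(cos_norm d) -(cos_norm b) leNgt; apply/negP => lt.
  have := bump_lipschitz x y; rewrite leNgt.
  have -> // : `|x - y| < `|bump s x - bump s y|.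
  rewrite -(@ltr_pM2r _ 2^-1) ?invr_gt0 // -normd -normb.
  rewrite -ltr_cos ?in_itv //= normr_ge0 /=; first by rewrite normd; lra.
  by apply: le_trans (_ : pi / 2 <= _); [rewrite ler_norml /b; apply/andP; split; lra | lra].
have : sin a <= sin (bump s m).
  rewrite sin_bump -(ler_pM2r cosb) sum ler_wpM2l //.
  by rewrite mulr_ge0 // cos_ge0_pihalf.
rewrite leNgt ltr_sin ?in_itv /=.
- by rewrite -leNgt /a ler_pdivrMr // mulr_natr.
- by rewrite !ltW.
by rewrite /a; apply/andP; split; lra.
Qed.

Let slope_ge0 e : 0 <= e <= pi -> 0 <= slope e.
Proof. by move=> he; rewrite divr_ge0 ?sqrtr_ge0 // mulr_ge0 // sin_ge0_pi. Qed.

Let slope_mono x y : 0 <= x -> x <= y -> y <= pi / 2 -> slope x <= slope y.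
Proof.
move=> x0 xy ypi; have pi0 : 0 < pi :> R := pi_gt0 R.
rewrite -ler_sqr ?nnegrE ?slope_ge0 //; try by apply/andP; split; lra.
rewrite /slope !expr_div_n !sqr_sqrtr ?(ltW (rad_gt0 _)) //.
rewrite ler_pdivrMr ?rad_gt0 // mulrAC ler_pdivlMr ?rad_gt0 //.
rewrite !exprMn !cos2sin2.
have : sin x ^+ 2 <= sin y ^+ 2.
  rewrite ler_sqr ?nnegrE ?sin_ge0_pi //; try by apply/andP; split; lra.
  by rewrite leNgt ltr_sin ?in_itv /= -?leNgt //; apply/andP; split; lra.
set X := sin x ^+ 2; set Y := sin y ^+ 2 => XY.
have S1 : s ^+ 2 <= 1 by rewrite expr_le1 // ltW.
have S0 : 0 <= s ^+ 2 by rewrite sqr_ge0.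
(* The squared slopes have been cross-multiplied; the difference of the two sides factors through
   [Y - X]. *)
rewrite -subr_ge0.
have -> : s ^+ 2 * Y * (1 - s ^+ 2 * (1 - X)) - s ^+ 2 * X * (1 - s ^+ 2 * (1 - Y))
  = s ^+ 2 * (1 - s ^+ 2) * (Y - X) by ring.
by rewrite !mulr_ge0 // subr_ge0.
Qed.

(** By [slope_mono] the bump is concave on [[0, pi / 2]], hence lies below its tangent at [t]; [- k]
    is the slope of that tangent. *)
Lemma bump_tangent t : 0 <= t <= pi / 2 -> exists2 k, 0 <= k &
  forall e, 0 <= e <= pi / 2 -> bump s e <= bump s t - k * (e - t).
Proof.
move=> /andP[t0 tpi]; have pi0 : 0 < pi :> R := pi_gt0 R.
exists (slope t); first by apply: slope_ge0; apply/andP; split; lra.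
move=> e /andP[e0 epi].
have [et|/ltW te] := lerP e t.
  have [c /andP[ec ct] eq] := bump_mvt et.
  have : slope c * (t - e) <= slope t * (t - e).
    by rewrite ler_wpM2r ?subr_ge0 // slope_mono //; lra.
  lra.
have [c /andP[tc ce] eq] := bump_mvt te.
have : slope t * (e - t) <= slope c * (e - t).
  by rewrite ler_wpM2r ?subr_ge0 // slope_mono //; lra.
lra.
Qed.

Definition centered e := - (pi / 2) <= e <= pi / 2.

(* Reducing the [e]'s modulo [pi] changes the sign of their bumps; two negative
   bumps cancel out modulo [2 pi], so that at most one of them has to be kept. *)
Lemma center_seq (l : seq R) :
  (exists (m : int) (l' : seq R), [/\ size l' = size l, all centered l',
     \sum_(e <- l) e = \sum_(e <- l') e + m%:~R * (pi *+ 2)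
   & \sum_(e <- l) bump s e <= \sum_(e <- l') bump s e])
  \/ (exists (m : int) a (l' : seq R), [/\ (size l').+1 = size l,
     all centered (a :: l'),
     \sum_(e <- l) e = a + \sum_(e <- l') e + m%:~R * (pi *+ 2) + pi
   & \sum_(e <- l) bump s e <= - bump s a + \sum_(e <- l') bump s e]).
Proof.
elim: l => [|e l IH].
  by left; exists 0, [::]; rewrite !big_nil /= mul0r addr0.
have [m0 [b [e0 [he0 eE]]]] := mod_pi_centered e.
have G0 := bump_ge0 he0.
have Ge : bump s e = if b then - bump s e0 else bump s e0.
  by rewrite eE; case: b {eE} => /=; rewrite ?mul1r ?mul0r ?addr0 ?bumpDpi bumpD2intpi.
rewrite !big_cons Ge eE {Ge eE}.
case: IH => [[m [l' [sz cl sumE sumG]]]|[m [a [l' [sz /= /andP[ca cl] sumE sumG]]]]];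
  rewrite sumE /=.
  case: b.
    right; exists (m0 + m), e0, l'; rewrite /= sz /centered he0 cl; split => //.
      by rewrite intrD mul1r; ring.
    by rewrite lerD2l.
  left; exists (m0 + m), (e0 :: l').
  rewrite !big_cons /= sz /centered he0 cl; split => //.
    by rewrite intrD mul0r; ring.
  by rewrite lerD2l.
have Ga := bump_ge0 ca.
case: b.
  left; exists (m0 + m + 1), [:: e0, a & l'].
  rewrite !big_cons /= sz ca cl {1}/centered he0; split => //; last by lra.
  by rewrite !intrD mul1r; ring.
right; exists (m0 + m), a, (e0 :: l').
rewrite !big_cons /= sz ca cl {1}/centered he0; split => //; last by lra.
by rewrite intrD mul0r; ring.
Qed.

(* If one negative bump is left, it is paired with another one and both are
   replaced by the bump at their midpoint. *)
Lemma center_seq_even (l : seq R) : (2 <= size l)%N ->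
  exists (m : int) (l' : seq R), [/\ size l' = size l, all centered l',
     \sum_(e <- l) e = \sum_(e <- l') e + m%:~R * (pi *+ 2)
   & \sum_(e <- l) bump s e <= \sum_(e <- l') bump s e].
Proof.
move=> l2; have pi0 : 0 < pi :> R := pi_gt0 R.
case: (center_seq l) => // -[m [a [[|c t] [sz]]]]; first by rewrite -sz in l2.
move=> /= /and3P[ca cc ct]; rewrite !big_cons => sumE sumG.
have /andP[a1 a2] := ca; have /andP[c1 c2] := cc.
(* Since [- bump s a] is the bump at [a - pi] and at [a + pi], [a] may be moved either way, which
   moves the midpoint by [pi / 2]. The boolean [b] selects the direction that keeps the midpoint
   centered. *)
have key b : (a + (b * (pi *+ 2) - pi) + c) / 2 = (a + c) / 2 + b * pi - pi / 2 by field.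
have {}key (b : bool) : centered ((a + c) / 2 + b%:R * pi - pi / 2) ->
    - bump s a + bump s c <= bump s ((a + c) / 2 + b%:R * pi - pi / 2) *+ 2.
  rewrite -key => hc.
  have <- : bump s (a + (b%:R * (pi *+ 2) - pi)) = - bump s a.
    rewrite -bumpDpi -(bumpD2intpi s (a + pi) ((b : nat)%:Z - 1)); congr bump.
    by rewrite rmorphB /= -pmulrn; ring.
  apply: bump_midpoint => //.
  by rewrite ler_norml; apply/andP; case: b hc => /= _; split; lra.
have [b hb] : exists b : bool, centered ((a + c) / 2 + b%:R * pi - pi / 2).
  have [ac|/ltW ac] := lerP 0 ((a + c) / 2); [exists false|exists true];
   rewrite /centered /=; apply/andP; split; lra.
set d := _ - _ in hb key *.
exists (m + 1 - (b : nat)%:Z), [:: d, d & t].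
rewrite !big_cons /= hb ct -sz; split => //; last by have := key b hb; lra.
by rewrite sumE /d rmorphB rmorphD /= -pmulrn; field.
Qed.

(** Jensen's inequality once the angles are centered: each bump is bounded by the tangent at
    [|E / n|]. As the tangent does not increase, it remains to see that the [|e|] sum up to at least
    [|E|], and a number in [[- pi, pi]] has the least absolute value in its class modulo [2 pi]. *)
Lemma sum_bump_le (l : seq R) (E : R) (m : int) : (2 <= size l)%N ->
  `|E| <= pi -> \sum_(e <- l) e = E + m%:~R * (pi *+ 2) ->
  \sum_(e <- l) bump s e <= (size l)%:R * bump s (E / (size l)%:R).
Proof.
move=> l2 Epi sumE; have pi0 : 0 < pi :> R := pi_gt0 R.
have [m' [l' [sz cl sumE' sumG]]] := center_seq_even l2.
apply: le_trans sumG _; move: sumE; rewrite sumE' -sz in l2 * => {sumE' sz l} sumE.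
set n := size l' in l2 *.
have n2 : 2 <= n%:R :> R by rewrite (ler_nat _ 2).
have n0 : 0 < n%:R :> R by apply: lt_le_trans n2.
set t := E / n%:R.
(* The point of tangency is at most [pi / 2] because [|E| <= pi] and [n >= 2]. *)
have [k k0 tangent] : exists2 k, 0 <= k &
    forall e, 0 <= e <= pi / 2 -> bump s e <= bump s `|t| - k * (e - `|t|).
  apply: bump_tangent; rewrite normr_ge0 /= normrM normfV (gtr0_norm n0).
  by rewrite ler_pdivrMr //; apply: le_trans Epi _; rewrite -mulrA ler_peMr //; lra.
have le_abs : `|E| <= \sum_(e <- l') `|e|.
  apply: le_trans (_ : `|\sum_(e <- l') e| <= _); last exact: ler_norm_sum.
  have -> : \sum_(e <- l') e = E + (m - m')%:~R * (pi *+ 2).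
    by rewrite rmorphB /=; lra.
  case: (eqVneq (m - m') 0) => [->|mm]; first by rewrite mul0r addr0.
  have : 1 <= `|(m - m')%:~R| :> R by rewrite norm_intr_ge1 ?intr_int ?intr_eq0.
  set z := _%:~R => z1.
  have : pi *+ 2 <= `|z * (pi *+ 2)|.
    have T0 : 0 < pi *+ 2 :> R by rewrite pmulrn_lgt0.
    by rewrite normrM (gtr0_norm T0) ler_peMl // ltW.
  have := ler_normB (E + z * (pi *+ 2)) E.
  by rewrite [E + _ - E]addrAC subrr add0r; lra.
apply: le_trans (_ : \sum_(e <- l') (bump s `|t| - k * (`|e| - `|t|)) <= _).
  rewrite big_seq [leRHS]big_seq; apply: ler_sum => e /(allP cl) ce.
  by rewrite -[bump s e]bump_norm tangent // normr_ge0 ler_norml.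
have sum_const (c : R) : \sum_(e <- l') c = n%:R * c.
  by rewrite big_const_seq count_predT iter_addr_0 mulr_natl.
rewrite big_split /= sumrN -mulr_sumr big_split /= sumrN !sum_const bump_norm.
rewrite gerBl mulr_ge0 // subr_ge0.
by rewrite normrM normfV (gtr0_norm n0) mulrCA divff ?mulr1 // gt_eqF.
Qed.

End Bump.

(** * Differences of arctangents *)

Lemma tanB_sin x y : cos x != 0 -> cos y != 0 ->
  tan y - tan x = sin (y - x) / (cos x * cos y).
Proof. by move=> cx cy; rewrite /tan sinB; field; rewrite cx cy. Qed.

Lemma cos_atan_gt0 x : 0 < cos (atan x).
Proof. by apply: cos_gt0_pihalf; rewrite atan_gtNpi2 atan_ltpi2. Qed.

Lemma sin_atan_ge0_lt1 x : 0 <= x -> 0 <= sin (atan x) < 1.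
Proof.
move=> x0; have a0 : 0 <= atan x by rewrite -atan0 le_atan.
have pi0 : 0 < pi :> R := pi_gt0 R; have api := atan_ltpi2 x.
apply/andP; split; first by apply: sin_ge0_pi; apply/andP; split; lra.
by rewrite -sin_pihalf ltr_sin ?in_itv //=; apply/andP; split; lra.
Qed.

(** With [B] and [A] the two arctangents, [D = tan B - tan A = 2 tan mu]. By [tanB_sin] and [2 cos A
    cos B = cos (B - A) + cos (B + A)], this becomes [sin (B - A - mu) = sin mu * cos (B + A)],
    which is then inverted by [asin]. *)
Lemma atan_gap D y : 0 < D -> let mu := atan (D / 2) in
  atan (y + D) - atan y = mu + bump (sin mu) (atan (y + D) + atan y).
Proof.
move=> D0 mu; have pi0 : 0 < pi :> R := pi_gt0 R.
have D20 : 0 <= D / 2 by rewrite divr_ge0 // ltW.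
have /andP[s0 s1] := sin_atan_ge0_lt1 D20; rewrite -/mu in s0 s1.
have mu0 : 0 < mu by rewrite -atan0 lt_atan // divr_gt0.
have mupi : mu < pi / 2 := atan_ltpi2 _.
have cmu : 0 < cos mu := cos_atan_gt0 _.
have DE : D = 2 * (sin mu / cos mu).
  by have := atanK (D / 2); rewrite -/mu /tan => ->; field.
set B := atan (y + D); set A := atan y.
have AB : A < B by rewrite lt_atan // ltrDl.
have [A1 A2] : - (pi / 2) < A /\ A < pi / 2 by rewrite atan_gtNpi2 atan_ltpi2.
have [B1 B2] : - (pi / 2) < B /\ B < pi / 2 by rewrite atan_gtNpi2 atan_ltpi2.
have cA : cos A != 0 by rewrite gt_eqF ?cos_atan_gt0.
have cB : cos B != 0 by rewrite gt_eqF ?cos_atan_gt0.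
have key : sin (B - A - mu) = sin mu * cos (B + A).
  have : D = sin (B - A) / (cos A * cos B).
    by rewrite -tanB_sin // !atanK; ring.
  rewrite {1}DE => /(congr1 (fun z => z * (cos A * cos B) * cos mu)).
  have -> : sin (B - A) / (cos A * cos B) * (cos A * cos B) * cos mu
    = sin (B - A) * cos mu by field; rewrite cA cB.
  have -> : 2 * (sin mu / cos mu) * (cos A * cos B) * cos mu =
    2 * sin mu * (cos A * cos B) by field; rewrite gt_eqF.
  move=> eq; by rewrite (sinB (B - A)) -eq (cosB B) (cosD B); ring.
(* The inversion needs an angle of at most [pi / 2]. Otherwise its supplement, which exceeds [mu]
   because [B - A < pi], would have a sine larger than [sin mu]. *)
have le_pi : B - A - mu <= pi / 2.
  rewrite leNgt; apply/negP => lt.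
  have : sin mu < sin (pi - (B - A - mu)).
    by rewrite ltr_sin ?in_itv //=; try (apply/andP; split); lra.
  have -> : pi - (B - A - mu) = - (B - A - mu) + pi by ring.
  rewrite sinDpi sinN opprK key ltNge => /negP; apply.
  by rewrite ler_piMr // cos_le1.
suff -> : bump (sin mu) (B + A) = B - A - mu by ring.
by rewrite /bump -key sinK // in_itv /=; apply/andP; split; lra.
Qed.

(** The left-hand side of the conclusion is the value of [D] for which every sum of arctangents is
    [E / n] and every difference is [pi / n]. The bound [|E| + pi < n * pi] keeps both arguments of
    [tan] inside [(- pi / 2, pi / 2)]. *)
Lemma atan_gap_sum (ys : seq R) D (E : R) (m : int) :
  let n := (size ys)%:R : R in
  0 < D -> (2 <= size ys)%N -> `|E| <= pi -> `|E| + pi < n * pi ->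
  \sum_(y <- ys) (atan (y + D) - atan y) = pi ->
  \sum_(y <- ys) (atan (y + D) + atan y) = E + m%:~R * (pi *+ 2) ->
  tan ((E + pi) / (n *+ 2)) - tan ((E - pi) / (n *+ 2)) <= D.
Proof.
move=> n D0 n2 Epi Epin diffE sumE; have pi0 : 0 < pi :> R := pi_gt0 R.
have n0 : 0 < n by rewrite ltr0n (leq_trans _ n2).
have n20 : 0 < n *+ 2 by rewrite pmulrn_lgt0.
set A := (E - pi) / _; set B := (E + pi) / _.
have /ler_normlP[E1 E2] : `|E| <= `|E| := lexx _.
have [A1 A2] : - (pi / 2) < A /\ A < pi / 2.
  by rewrite /A ltr_pdivrMr // ltr_pdivlMr //; split; lra.
have [B1 B2] : - (pi / 2) < B /\ B < pi / 2.
  by rewrite /B ltr_pdivrMr // ltr_pdivlMr //; split; lra.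
have cA : 0 < cos A by apply: cos_gt0_pihalf; rewrite A1 A2.
have cB : 0 < cos B by apply: cos_gt0_pihalf; rewrite B1 B2.
have D20 : 0 <= D / 2 by rewrite divr_ge0 // ltW.
pose mu := atan (D / 2).
have /andP[s0 s1] := sin_atan_ge0_lt1 D20; rewrite -/mu in s0 s1.
have mu0 : 0 < mu by rewrite -atan0 lt_atan // divr_gt0.
have mupi : mu < pi / 2 := atan_ltpi2 _.
have cmu : 0 < cos mu := cos_atan_gt0 _.
have DE : D = 2 * (sin mu / cos mu).
  by have := atanK (D / 2); rewrite -/mu /tan => ->; field.
have BA : B - A = pi / n by rewrite /A /B; field; rewrite gt_eqF.
have BDA : B + A = E / n by rewrite /A /B; field; rewrite gt_eqF.
have : pi <= n * (mu + bump (sin mu) (B + A)).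
  rewrite -{1}diffE; under eq_bigr do rewrite atan_gap //.
  have sum_mu : \sum_(y <- ys) mu = n * mu.
    by rewrite big_const_seq count_predT iter_addr_0 mulr_natl.
  rewrite big_split /= sum_mu mulrDr lerD2l.
  have := sum_bump_le s0 s1 (l := [seq atan (y + D) + atan y | y <- ys]) (E := E) (m := m).
  by rewrite size_map !big_map -/n BDA; apply.
rewrite mulrC -ler_pdivrMr // -BA => le.
have /andP[G1 G2] := bump_pihalf s0 s1 (B + A).
have : sin (B - A - mu) <= sin mu * cos (B + A).
  rewrite -(sin_bump s0 s1) leNgt ltr_sin ?in_itv /=.
  - by rewrite -leNgt; lra.
  - by rewrite !ltW.
  have BA0 : 0 < B - A by rewrite BA divr_gt0.
  by apply/andP; split; lra.
(* The computation of [atan_gap] is run backwards, from the inequality between sines to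
   [tan B - tan A <= 2 tan mu]. *)
rewrite (sinB (B - A)) (cosB B) (cosD B) => {}le.
rewrite tanB_sin ?gt_eqF // ler_pdivrMr ?mulr_gt0 // DE.
have -> : 2 * (sin mu / cos mu) * (cos A * cos B) = 2 * sin mu * (cos A * cos B) / cos mu.
  by ring.
by rewrite ler_pdivlMr //; lra.
Qed.

Lemma sum_atan_separated (h u d : R) (s : seq R) : 0 < h ->
  sorted (fun x y => x + d <= y) s ->
  \sum_(x <- s) (atan ((u + d - x) / h) - atan ((u - x) / h)) < pi.
Proof.
move=> h0; have pi0 : 0 < pi :> R := pi_gt0 R.
(* The intervals move to the left as the roots grow, so the sum is bounded by the variation of
   [atan] to the left of the right end of the first interval; this form passes through the
   induction. *)
suff path_lt x t : path (fun x y => x + d <= y) x t ->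
    \sum_(y <- x :: t) (atan ((u + d - y) / h) - atan ((u - y) / h))
      < atan ((u + d - x) / h) + pi / 2.
  case: s => [|x t /path_lt lt]; first by rewrite big_nil.
  by apply: lt_trans lt _; have := atan_ltpi2 ((u + d - x) / h); lra.
elim: t x => [|y t IH] x /=.
  by move=> _; rewrite big_seq1; have := atan_gtNpi2 ((u - x) / h); lra.
move=> /andP[xy /IH lt]; rewrite big_cons.
have : atan ((u + d - y) / h) <= atan ((u - x) / h).
  by apply: le_atan; rewrite ler_pM2r ?invr_gt0 //; lra.
lra.
Qed.

End Trig.

(** * Mesh and roots *)

Section Mesh.
Variable R : realType.
Implicit Types (p q : {poly R}) (s : seq R).

Lemma mem_realroots q x : q != 0 -> (x \in realroots q) = root q x.
Proof.
move=> q0; rewrite -has_pred1 has_count count_realroots //.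
by rewrite -XsubC_dvd // dvdp_XsubCl.
Qed.

Lemma mesh_le_gap q v w : root q v -> root q w -> q != 0 -> v < w ->
  (mesh q <= (w - v)%:E)%E.
Proof.
move=> qv qw q0 vw; rewrite -!mem_realroots // in qv qw.
have srt := realroots_sorted q; rewrite /mesh; set s := realroots q in qv qw srt *.
have nthv := nth_index 0 qv; have nthw := nth_index 0 qw.
set i := index v s in nthv *; set j := index w s in nthw *.
have js : (j < size s)%N by rewrite index_mem.
have is_ : (i < size s)%N by rewrite index_mem.
have mono := sorted_leq_nth le_trans lexx 0 srt.
have ij : (i < j)%N.
  rewrite ltnNge; apply/negP => ji.
  by have := mono j i js is_ ji; rewrite nthv nthw leNgt vw.
have i1s : (i.+1 < size s)%N by apply: leq_ltn_trans js.
apply: (bigmin_inf_seq _ (i : nat)) => //.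
  by rewrite mem_index_iota ltn_predRL.
by rewrite lee_fin nthv lerD2r -nthw mono.
Qed.

(** Simplicity of the roots makes [realroots q] strictly increasing, so every term of the minimum is
    a gap between two distinct roots. *)
Lemma le_mesh q (m : \bar R) : (forall x, root q x -> ~~ root q^`() x) ->
  (forall v w, root q v -> root q w -> v < w -> (m <= (w - v)%:E)%E) ->
  (m <= mesh q)%E.
Proof.
move=> simple gap.
(* The zero polynomial would share the root [0] with its derivative. *)
have q0 : q != 0.
  by apply/eqP => q0; have := simple 0; rewrite q0 linear0 root0 => /(_ isT).
have srt : sorted <%R (realroots q).
  rewrite lt_sorted_uniq_le realroots_sorted andbT.
  apply: count_mem_uniq => x; rewrite mem_realroots // count_realroots //.
  case: (boolP (root q x)) => [qx|/mupNroot -> //].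
  apply/eqP; rewrite eqn_leq -XsubC_dvd // dvdp_XsubCl qx andbT -ltnS mup_ltn //.
  apply: contra (simple x qx) => /dvdpP[r ->].
  by rewrite expr2 mulrA derivM derivXsubC rootE !(hornerE, subrr, mulr0, mulr1, mul0r, addr0).
rewrite /mesh big_nat; apply: le_bigmin; first exact: leey.
move=> j /andP[_]; set s := realroots q in srt *.
case sz : (size s) => [//|k] /= jk.
have jmem i : (i <= k)%N -> root q s`_i.
  by move=> ik; rewrite -mem_realroots // mem_nth // -/s sz ltnS.
apply: gap; rewrite ?jmem // ?(ltnW jk) //.
by move/(sortedP 0): srt; apply; rewrite sz ltnS.
Qed.

Lemma le_mesh_sorted (C d : R) s : C != 0 -> sorted <=%R s ->
  (d%:E <= mesh (C *: \prod_(x <- s) ('X - x%:P)))%E ->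
  sorted (fun x y => x + d <= y) s.
Proof.
move=> C0 ss; rewrite /mesh realroots_prod // => le.
apply/(sortedP 0) => i is_; rewrite -lerBrDl -lee_fin; apply: le_trans le _.
apply: ge_bigmin_seq => //.
by rewrite mem_index_iota ltn_predRL.
Qed.
End Mesh.

(** * Roots of [Delta] *)

Section DeltaRoots.
Local Open Scope complex_scope.
Variable R : realType.
Implicit Types (p : {poly R}) (s : seq R) (theta h u x C : R).

Lemma expiD (a b : R) : expi (a + b) = expi a * expi b.
Proof. by rewrite /expi cosD sinD; congr (_ +i* _); ring. Qed.

(** At a real point the two terms of [DeltaC] are complex conjugates, as [p] has real coefficients;
    their difference over [2i] is an imaginary part. *)
Lemma horner_Delta theta h p u :
  (Delta theta h p).[u] = complex.Im (expi theta * (polyRC p).[u +i* h]).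
Proof.
set z := u +i* h; set P := polyRC p.
have zE : u%:C + 'i * h%:C = z.
  by apply/eqP; rewrite eq_complex /= !(mul0r, mulr0, mul1r, subr0, addr0, add0r) !eqxx.
have zJ : u%:C - 'i * h%:C = z^*.
  by apply/eqP; rewrite eq_complex /= !(mul0r, mulr0, mul1r, subr0, addr0, add0r, oppr0) !eqxx.
have PJ : map_poly conjc P = P.
  by apply/polyP => i; rewrite !coef_map /= oppr0.
have expiN : expi (- theta) = (expi theta)^* by rewrite /expi /= cosN sinN.
have PzJ : P.[z^*] = P.[z]^*.
  by rewrite -{1}PJ -(horner_map conjc).
apply: (fmorph_inj (real_complex R)).
rewrite -horner_map -/(polyRC _) DeltaE /DeltaC -/P.
rewrite hornerZ hornerD hornerN !hornerZ !horner_comp !hornerD hornerN hornerX !hornerC.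
rewrite zE zJ PzJ expiN -(rmorphM (@conjc R)) subcJ mulrAC mulKf //.
by rewrite mulf_neq0 ?pnatr_eq0 // eq_complex /= oner_eq0 andbF.
Qed.

Lemma deriv_polyRC p : (polyRC p)^`() = polyRC p^`().
Proof. exact: (deriv_map (real_complex R)). Qed.

Lemma deriv_Delta theta h p : (Delta theta h p)^`() = Delta theta h p^`().
Proof.
apply: (map_poly_inj (real_complex R)).
rewrite -!/(polyRC _) -deriv_polyRC !DeltaE /DeltaC derivZ derivB !derivZ !deriv_comp.
by rewrite derivD derivB !derivX !derivC addr0 subr0 !mulr1 deriv_polyRC.
Qed.

Lemma polyRC_prod C s :
  polyRC (C *: \prod_(x <- s) ('X - x%:P)) = C%:C *: \prod_(x <- s) ('X - (x%:C)%:P).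
Proof.
rewrite /polyRC map_polyZ /= rmorph_prod; congr (_ *: _); apply: eq_bigr => x _.
by rewrite rmorphB /= map_polyX map_polyC.
Qed.

(** An argument of the product of [expi theta] and the [u - x + i h], chosen continuous in [u]. *)
Definition phase theta h s u := theta + \sum_(x <- s) (pi / 2 - atan ((u - x) / h)).

Lemma polar_atan h u : 0 < h ->
  u +i* h = (h / cos (atan (u / h)))%:C * expi (pi / 2 - atan (u / h)).
Proof.
move=> h0; set a := atan _.
have ca : cos a != 0 by rewrite gt_eqF // cos_atan_gt0.
have ta : sin a = u / h * cos a.
  by have := atanK (u / h); rewrite -/a /tan => <-; rewrite divfK.
rewrite /expi [pi / 2 - a]addrC cosDpihalf sinDpihalf sinN cosN opprK ta.
by apply/eqP; rewrite eq_complex /= !(mul0r, subr0, addr0); apply/andP; split; apply/eqP; field; rewrite ?ca ?gt_eqF.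
Qed.

Lemma polar_prod h s u : 0 < h -> exists2 r, 0 < r &
  \prod_(x <- s) ((u +i* h) - x%:C) = r%:C * expi (phase 0 h s u).
Proof.
move=> h0; elim: s => [|x s [r r0 IH]].
  exists 1 => //; rewrite big_nil /phase big_nil addr0 /expi cos0 sin0.
  by rewrite mulr1.
exists (h / cos (atan ((u - x) / h)) * r).
  by rewrite mulr_gt0 // divr_gt0 // cos_atan_gt0.
rewrite big_cons IH /phase big_cons !add0r expiD rmorphM /=.
have -> : (u +i* h) - x%:C = (u - x) +i* h by apply/eqP; rewrite eq_complex /= subr0 !eqxx.
by rewrite (polar_atan (u - x) h0); ring.
Qed.

Lemma horner_Delta_prod theta h C s u : 0 < h -> exists2 r, 0 < r &
  (Delta theta h (C *: \prod_(x <- s) ('X - x%:P))).[u]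
    = C * r * sin (phase theta h s u).
Proof.
move=> h0; have [r r0 rE] := polar_prod s u h0; exists r => //.
rewrite horner_Delta polyRC_prod hornerZ horner_prod.
under eq_bigr do rewrite hornerXsubC.
rewrite rE.
have -> : phase theta h s u = theta + phase 0 h s u by rewrite /phase add0r.
by rewrite sinD /=; ring.
Qed.

Lemma root_Delta_prod theta h C s u : 0 < h -> C != 0 ->
  root (Delta theta h (C *: \prod_(x <- s) ('X - x%:P))) u
    = (sin (phase theta h s u) == 0).
Proof.
move=> h0 C0; have [r r0 rE] := horner_Delta_prod theta C s u h0.
by rewrite rootE rE mulf_eq0 mulf_eq0 (negPf C0) gt_eqF.
Qed.

(* Each [1 / (z - x)] lies in the lower half plane. *)
Lemma Im_logderiv_lt0 h s u (P := \prod_(x <- s) ('X - (x%:C)%:P)) :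
  0 < h -> s != [::] -> complex.Im (P^`().[u +i* h] / P.[u +i* h]) < 0.
Proof.
move=> h0 s0; set z := u +i* h.
have zx0 x : z - x%:C != 0 by rewrite eq_complex /= subr0 (gt_eqF h0) andbF.
have Im_inv x : complex.Im (z - x%:C)^-1 < 0.
  rewrite /= subr0 oppr_lt0 divr_gt0 //.
  by rewrite ltr_wpDl ?sqr_ge0 // exprn_gt0.
have -> : P^`().[z] / P.[z] = \sum_(x <- s) (z - x%:C)^-1.
  rewrite {s0}/P; elim: s => [|x s IH]; first by rewrite !big_nil derivC horner0 mul0r.
  rewrite !big_cons derivM derivXsubC mul1r hornerD !hornerM hornerXsubC -IH.
  set Q := \prod_(y <- s) _.
  have Q0 : Q.[z] != 0.
    rewrite horner_prod prodf_seq_neq0; apply/allP => y _ /=.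
    by rewrite hornerXsubC zx0.
  by field; rewrite Q0 zx0.
rewrite raddf_sum /=.
case: s s0 {P} => // x s _; rewrite big_cons -[ltRHS]addr0 ltr_leD ?Im_inv //.
by rewrite sumr_le0 // => y _; rewrite ltW ?Im_inv.
Qed.

(** At a common root of [D] and its derivative, the values of [P] and its derivative at [u + i h],
    multiplied by the same constant, would both be real. So would the logarithmic derivative,
    against [Im_logderiv_lt0]. *)
Lemma Delta_simple_roots theta h C s u : 0 < h -> C != 0 -> s != [::] ->
  let D := Delta theta h (C *: \prod_(x <- s) ('X - x%:P)) in
  root D u -> ~~ root D^`() u.
Proof.
move=> h0 C0 s0 D Du; apply/negP => D'u.
have lt0 := Im_logderiv_lt0 u h0 s0.
move: D'u Du; rewrite !rootE /D deriv_Delta !horner_Delta {D}.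
rewrite -deriv_polyRC polyRC_prod derivZ !hornerZ.
move: lt0; set P := \prod_(x <- s) _; set z := _ +i* _.
set a := P^`().[z]; set b := P.[z] => /= lt0 /eqP Im1 /eqP Im2.
have P0 : b != 0.
  by apply/eqP => b0; move: lt0; rewrite b0 invr0 mulr0 ltxx.
set w := expi theta; set c := C%:C.
have nzc : c != 0 by rewrite fmorph_eq0.
have nzw : w != 0.
  rewrite /w /expi eq_complex /=; apply/negP => /andP[/eqP c0 /eqP si0].
  by have := cos2Dsin2 theta; rewrite c0 si0 !expr0n addr0 => /eqP; rewrite eq_sym oner_eq0.
have E : a / b = (w * (c * a)) / (w * (c * b)).
  by field; rewrite P0 nzc nzw.
move: lt0; rewrite E.
have real_div (x y : R[i]) : complex.Im x = 0 -> complex.Im y = 0 -> complex.Im (x / y) = 0.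
  by case: x y => [x1 x2] [y1 y2] /= -> ->; ring.
by rewrite real_div // ltxx.
Qed.

End DeltaRoots.

(** * Lower bounds for the gaps between roots of [Delta] *)

Section Gaps.
Variables (R : realType) (h theta : R).
Hypothesis h0 : 0 < h.
Implicit Types (s : seq R) (u w x C : R).

Lemma continuous_phase s : continuous (phase theta h s).
Proof.
move=> u; rewrite /phase; apply: cvgD; first exact: cvg_cst.
elim: s => [|x s IH].
  by under eq_fun do rewrite big_nil; rewrite big_nil; exact: cvg_cst.
under eq_fun do rewrite big_cons; rewrite big_cons; apply: cvgD => //.
apply: cvgB; first exact: cvg_cst.
apply: (@continuous_comp R R R (fun u => (u - x) / h) (@atan R)); last exact: continuous_atan.
by apply: cvgMl; apply: cvgB; [exact: cvg_id|exact: cvg_cst].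
Qed.

Lemma phaseB s u w :
  phase theta h s u - phase theta h s w
    = \sum_(x <- s) (atan ((w - x) / h) - atan ((u - x) / h)).
Proof.
rewrite /phase addrAC opprD addrA subrr add0r addrC -sumrB.
by apply: eq_bigr => x _; ring.
Qed.

Lemma phase_lt s u w : s != [::] -> u < w -> phase theta h s w < phase theta h s u.
Proof.
move=> s0 uw; rewrite -subr_gt0 phaseB.
have lt x : 0 < atan ((w - x) / h) - atan ((u - x) / h).
  by rewrite subr_gt0 lt_atan // ltr_pM2r ?invr_gt0 // ltrD2r.
case: s s0 => // x s _; rewrite big_cons ltr_wpDr //.
by apply: sumr_ge0 => y _; rewrite ltW.
Qed.

(** The phases at the roots are integral multiples of [pi], so a strict drop is at least [pi], and
    the intermediate value theorem gives [v]. *)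
Lemma phase_gap C s u w : C != 0 -> s != [::] -> u < w ->
  let D := Delta theta h (C *: \prod_(x <- s) ('X - x%:P)) in
  root D u -> root D w -> exists (k : int) v, [/\ u < v, v <= w,
    phase theta h s u = k%:~R * pi & phase theta h s v = phase theta h s u - pi].
Proof.
move=> C0 s0 uw D; rewrite !root_Delta_prod // => /eqP/sin0_intpi[k ku] /eqP/sin0_intpi[l lw].
have pi0 : 0 < pi :> R := pi_gt0 R.
have lt := phase_lt s0 uw.
have kl : l%:~R * pi <= phase theta h s u - pi.
  move: lt; rewrite ku lw ltr_pM2r // ltr_int => lk.
  have : (l + 1)%:~R * pi <= k%:~R * pi :> R by rewrite ler_pM2r // ler_int lezD1.
  by rewrite rmorphD /=; lra.
have cont : ({within `[u, w], continuous (phase theta h s)})%classic.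
  by apply: continuous_subspaceT; exact: continuous_phase.
have [|v] := IVT (v := phase theta h s u - pi) (ltW uw) cont.
  by rewrite ge_min le_max lw kl orbT /= gerBl ltW.
rewrite in_itv /= => /andP[uv vw] vE; exists k, v; split => //.
rewrite lt_neqAle uv andbT; apply: contraTneq pi0 => uvE.
by move: vE; rewrite uvE => vE; rewrite -leNgt; lra.
Qed.

Lemma mesh_le_Delta_gap C s u w : C != 0 -> sorted <=%R s -> s != [::] -> u < w ->
  let p := C *: \prod_(x <- s) ('X - x%:P) in
  root (Delta theta h p) u -> root (Delta theta h p) w ->
  (mesh p <= (w - u)%:E)%E.
Proof.
move=> C0 ss s0 uw p pu pw.
have [k [v [uv vw _ vE]]] := phase_gap C0 s0 uw pu pw.
rewrite leNgt; apply/negP => lt.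
have : ((v - u)%:E <= mesh p)%E.
  by apply: le_trans (ltW lt); rewrite lee_fin lerD2r.
move=> /(le_mesh_sorted C0 ss)/(sum_atan_separated u h0).
rewrite [u + _]addrC subrK -phaseB vE; lra.
Qed.

(** When the phase at [u] is a multiple of [pi] and drops by [pi], the sums of arctangents add up to
    [n pi + 2 theta + pi] modulo [2 pi]; [E] is its representative in [[- pi, pi)]. The second bound
    is immediate for [n >= 3]. For [n = 2] it fails only at [E = - pi], where [theta / pi] would be
    an integer strictly between 0 and 1. *)
Lemma centered_residue (n : nat) :
  (0 < theta < pi /\ (2 <= n)%N) \/ (theta = 0 /\ (3 <= n)%N) ->
  exists j : int, let E := n%:R * pi + theta *+ 2 + pi - j%:~R * (pi *+ 2) in
    `|E| <= pi /\ `|E| + pi < n%:R * pi.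
Proof.
move=> htheta; have pi0 : 0 < pi :> R := pi_gt0 R.
have pi20 : 0 < pi *+ 2 :> R by rewrite pmulrn_lgt0.
pose X := n%:R * pi + theta *+ 2 + pi.
pose t := (X + pi) / (pi *+ 2); pose j := Num.floor t.
have := floor_le_tmp t; have := floorD1_gt t.
rewrite -/j intrD ltr_pdivrMr // ler_pdivlMr // => lt ge.
exists j; set E := _ - _ => /=.
have E1 : - pi <= E by rewrite /E -/X; lra.
have E2 : E < pi by rewrite /E -/X; move: lt; rewrite mulrDl; lra.
have Epi : `|E| <= pi by rewrite ler_norml E1 ltW.
split => //.
have [n3|n2] := leqP 3 n.
  have : 3 * pi <= n%:R * pi :> R by rewrite ler_pM2r // ler_nat.
  lra.
case: htheta => [[/andP[t0 tpi] n2']|[_ n3]]; last by rewrite ltnNge n3 in n2.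
have nE : n = 2%N by apply/eqP; rewrite eqn_leq n2' -ltnS n2.
have nR : n%:R = 2 :> R by rewrite nE.
suff : `|E| < pi by rewrite nR; lra.
rewrite ltr_norml E2 andbT lt_neqAle E1 andbT.
apply/eqP => EE.
have tE : theta = (j - 2)%:~R * pi.
  by rewrite rmorphB /=; move: EE; rewrite /E nR; lra.
move: t0 tpi; rewrite tE pmulr_lgt0 // gtr_pMl // -[1]/(1%:~R) ltr0z ltr_int.
by case: (j - 2) => [[]|].
Qed.

Lemma mesh_Xn_le_Delta_gap C s u w (n := size s) : C != 0 -> s != [::] ->
  (0 < theta < pi /\ (2 <= n)%N) \/ (theta = 0 /\ (3 <= n)%N) -> u < w ->
  let p := C *: \prod_(x <- s) ('X - x%:P) in
  root (Delta theta h p) u -> root (Delta theta h p) w ->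
  (mesh (Delta theta h 'X^n) <= (w - u)%:E)%E.
Proof.
move=> C0 s0 htheta uw p pu pw; have pi0 : 0 < pi :> R := pi_gt0 R.
have n2 : (2 <= n)%N by case: htheta => -[_] // /ltnW.
have n0 : 0 < n%:R :> R by rewrite ltr0n (leq_trans _ n2).
have [k [v [uv vw uE vE]]] := phase_gap C0 s0 uw pu pw.
have [j [Epi Epin]] := centered_residue htheta.
set E := _ - _ in Epi Epin.
(* After division by [h] the data take the form required by [atan_gap_sum]. *)
pose D := (v - u) / h.
have D0 : 0 < D by rewrite divr_gt0 // subr_gt0.
have yD x : (u - x) / h + D = (v - x) / h by rewrite /D -mulrDl; congr (_ / _); ring.
have diffE : \sum_(y <- [seq (u - x) / h | x <- s]) (atan (y + D) - atan y) = pi.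
  by rewrite big_map; under eq_bigr do rewrite yD; rewrite -phaseB vE; ring.
have sumu : \sum_(x <- s) atan ((u - x) / h) = theta + n%:R * (pi / 2) - k%:~R * pi.
  rewrite -uE /phase sumrB big_const_seq count_predT iter_addr_0 -/n mulr_natl; ring.
have sumE : \sum_(y <- [seq (u - x) / h | x <- s]) (atan (y + D) + atan y)
    = E + (j - k)%:~R * (pi *+ 2).
  have -> : \sum_(y <- [seq (u - x) / h | x <- s]) (atan (y + D) + atan y)
    = pi + (\sum_(x <- s) atan ((u - x) / h)) *+ 2.
    rewrite -diffE !big_map mulr2n -!big_split /=.
    by apply: eq_bigr => x _; ring.
  by rewrite sumu /E rmorphB /=; field.
have := atan_gap_sum D0 _ Epi _ diffE sumE.
rewrite size_map -/n => /(_ n2 Epin).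
set A := (E - pi) / _; set B := (E + pi) / _ => le.
have n20 : 0 < n%:R *+ 2 :> R by rewrite pmulrn_lgt0.
have /ler_normlP[E1 E2] : `|E| <= `|E| := lexx _.
have hA : A \in `](- (pi / 2)), (pi / 2)[.
  by rewrite in_itv /=; rewrite /A ltr_pdivrMr // ltr_pdivlMr //; apply/andP; split; lra.
have hB : B \in `](- (pi / 2)), (pi / 2)[.
  by rewrite in_itv /=; rewrite /B ltr_pdivrMr // ltr_pdivlMr //; apply/andP; split; lra.
have AB : A < B by rewrite ltr_pM2r ?invr_gt0 //; lra.
have XnE : 'X^n = 1 *: \prod_(x <- nseq n 0) ('X - x%:P) :> {poly R}.
  by rewrite scale1r big_nseq subr0 iter_mulr_1.
have ns0 : nseq n (0 : R) != [::] by rewrite -size_eq0 size_nseq -lt0n (leq_trans _ n2).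
(* All roots of ['X^n] being 0, its phase at [h * tan a] is [theta + n (pi / 2 - a)]. It equals
   [j pi] at [a = A] and [(j - 1) pi] at [a = B]. *)
have rootXn a (m : int) : a \in `](- (pi / 2)), (pi / 2)[ ->
    theta + n%:R * (pi / 2 - a) = m%:~R * pi -> root (Delta theta h 'X^n) (h * tan a).
  have hK : h * tan a / h = tan a by rewrite mulrAC divff ?mul1r // gt_eqF.
  move=> ha eq; rewrite XnE root_Delta_prod ?oner_neq0 // /phase big_nseq iter_addr_0.
  rewrite subr0 hK tanK // -[_ *+ n]mulr_natl eq.
  by rewrite sin_intpi.
have rA : root (Delta theta h 'X^n) (h * tan A).
  by apply: (rootXn A j hA); rewrite /A /E; field; rewrite gt_eqF.
have rB : root (Delta theta h 'X^n) (h * tan B).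
  by apply: (rootXn B (j - 1) hB); rewrite /B /E rmorphB /=; field; rewrite gt_eqF.
have nz : Delta theta h 'X^n != 0.
  have := rA; rewrite XnE => /(Delta_simple_roots h0 (oner_neq0 _) ns0).
  by apply: contraNneq => ->; rewrite linear0 root0.
(* The gap [h (tan B - tan A)] is at most [h D = v - u], hence at most [w - u]. *)
apply: le_trans (mesh_le_gap rA rB nz _) _.
  by rewrite ltr_pM2l // ltr_tan.
rewrite lee_fin -mulrBr -ler_pdivlMl // mulrC.
by apply: le_trans le _; rewrite ler_pM2r ?invr_gt0 // lerD2r.
Qed.
End Gaps.

Theorem theorem1p9 (R : realType) (p : {poly R}) (n : nat) (theta h : R)
  (hp : hyperbolic p) (deg_p : size p = n.+1) (h_gt0 : 0 < h)
  (htheta : (0 < theta < pi /\ (2 <= n)%N) \/ (theta = 0 /\ (3 <= n)%N)) :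
  (mesh (Delta theta h p)
     >= Order.max (mesh p) (mesh (Delta theta h 'X^n)))%E /\
  (Order.max (mesh p) (mesh (Delta theta h 'X^n))
     >= mesh (Delta theta h 'X^n))%E.
Proof.
split; last by rewrite le_max lexx orbT.
have [s pE] := hyperbolic_prod hp.
have C0 : lead_coef p != 0 by rewrite lead_coef_eq0; case: hp.
have {}pE : p = lead_coef p *: \prod_(x <- sort <=%R s) ('X - x%:P).
  by rewrite {1}pE; congr (_ *: _); apply: perm_big; rewrite perm_sym perm_sort.
have ss : sorted <=%R (sort <=%R s) := sort_sorted le_total s.
move: (sort _ s) ss pE => {}s ss pE.
have sz : size s = n.
  by have := deg_p; rewrite pE size_scale // size_prod_XsubC => -[].
have s0 : s != [::].
  by rewrite -size_eq0 sz -lt0n; case: htheta => -[_]; case: (n).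
rewrite -sz in htheta *; move: pE C0; move: (lead_coef p) => C -> C0.
apply: le_mesh => [x|u w ru rw uw]; first exact: Delta_simple_roots.
rewrite ge_max; apply/andP; split.
  exact: mesh_le_Delta_gap ru rw.
exact: mesh_Xn_le_Delta_gap ru rw.
Qed.
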